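(* Let $\phi_0\in C_c^\infty(\mathbb{R})$ be an even function, let $q>1$ and $\varepsilon>0$ be such that $\phi_0|_{[-\varepsilon,\varepsilon]}\equiv 1$, and let $$\phi_{m+1}=\left(\mathrm{Id}-q^{-(m+1)}D_{1/q}\right)\phi_m\qquad\text{for all } m\in\{0,1,2,\ldots\}.$$ Then the sequence $\phi_m$ converges uniformly on $\mathbb{R}$ to a function $\psi$ as $m\to\infty$, and $\psi$ has the following properties: 1. $\psi$ is even; 2. there is a constant $c\neq0$ such that $\psi(0)=c$ and $\psi^{(k)}(0)=0$ for all $k\ge1$; 3. $\psi\in\mathcal{S}_1^*(\mathbb{R})$.
   Context: For $a>0$, $D_a$ is the dilation operator $D_af(x)=f(ax)$ and $\mathrm{Id}$ is the identity operator. Functions are real-valued. $\mathcal{S}_1^*(\mathbb{R})$ denotes the space of Schwartz functions $f\in\mathcal{S}(\mathbb{R})$ with infinitely many vanishing moments of order 1, i.e. $\int_{\mathbb{R}}f(\pm t)t^m\,dt=0$ for all integers $m\ge0$. *)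

(* Defs.v *)
From Stdlib Require Import Reals Rtopology.
From Coquelicot Require Import Coquelicot.
Open Scope R_scope.

Definition dilation (a : R) (f : R -> R) : R -> R := fun x => f (a * x).

Definition even_fun (f : R -> R) : Prop := forall x, f (- x) = f x.

Definition smooth (f : R -> R) : Prop := forall n x, ex_derive_n f n x.

(* [adherence] is the topological closure, so this is compactness of the
   support in the usual sense. *)
Definition compactly_supported (f : R -> R) : Prop :=
  Rtopology.compact (Rtopology.adherence (fun x => f x <> 0)).

Definition schwartz (f : R -> R) : Prop :=
  smooth f /\
  forall k n : nat, exists M : R, forall x, Rabs (x ^ k * Derive_n f n x) <= M.

(* Only used for rapidly decreasing integrands, for which the two-sided
   improper Riemann integral is the Lebesgue integral over the line. *)
Definition is_integral_line (f : R -> R) (l : R) : Prop :=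
  is_RInt_gen f (Rbar_locally m_infty) (Rbar_locally p_infty) l.

Definition schwartz_star_1 (f : R -> R) : Prop :=
  schwartz f /\
  forall m : nat,
    is_integral_line (fun t => f t * t ^ m) 0 /\
    is_integral_line (fun t => f (- t) * t ^ m) 0.

(* The balls of the uniform space [R -> R] bound the distance simultaneously at
   all points, so convergence in it is uniform convergence on the line. *)
Definition converges_uniformly (u : nat -> R -> R) (g : R -> R) : Prop :=
  filterlim u eventually (locally g).

(* Main.v *)
(* Put r = 1/q.  Since D_r multiplies the seminorm sup |x^k f^(n)(x)| by
   q^(k-n), the recursion makes each seminorm of phi_m grow at most by the
   factor 1 + q^k r^m per step.  These factors have a convergent product, so the
   steps phi_(m+1) - phi_m are O(r^m) in every seminorm and phi_m converges to psi
   in the Schwartz space.  The operator Id - r^(m+1) D_r multiplies the n-th moment by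
   1 - q^(n+1) r^(m+1), which is 0 for m = n: the n-th moment of phi_m vanishes
   for m > n, hence so does that of psi.  Near 0 each phi_m is the constant
   prod_(1 <= i <= m) (1 - r^i), which stays away from 0. *)

Require Import Defs.
From Stdlib Require Import Reals Rtopology Lra Lia.
From Coquelicot Require Import Coquelicot.
Open Scope R_scope.

(** * Geometric series estimates *)

(* Dominates the product of the [1 + K * r ^ i] over [i < m]. *)
Definition growth (r K : R) (m : nat) : R := exp (K * ((1 - r ^ m) / (1 - r))).

Lemma growth_0 (r K : R) : growth r K 0 = 1.
Proof.
unfold growth; simpl.
replace (K * ((1 - 1) / (1 - r))) with 0 by (unfold Rdiv; ring).
exact exp_0.
Qed.

Lemma growth_pos (r K : R) (m : nat) : 0 < growth r K m.
Proof. apply exp_pos. Qed.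

(** The exponent in [growth] is [K] times the geometric sum of the [r ^ i] with [i < m], so one more
    step adds [K * r ^ m] to it, and [1 + y <= exp y] does the rest. *)
Lemma growth_step (r K : R) (m : nat) (hr : r < 1) :
  (1 + K * r ^ m) * growth r K m <= growth r K (S m).
Proof.
unfold growth.
replace (K * ((1 - r ^ S m) / (1 - r)))
  with (K * r ^ m + K * ((1 - r ^ m) / (1 - r))) by (simpl; field; lra).
rewrite exp_plus.
apply Rmult_le_compat_r; [apply Rlt_le, exp_pos | apply exp_ineq1_le].
Qed.

Lemma growth_le (r K : R) (m : nat) (hr0 : 0 <= r) (hr1 : r < 1) (hK : 0 <= K) :
  growth r K m <= exp (K / (1 - r)).
Proof.
unfold growth.
assert (h : K * ((1 - r ^ m) / (1 - r)) <= K / (1 - r)).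
{ unfold Rdiv; rewrite <- Rmult_assoc.
  apply Rmult_le_compat_r; [apply Rlt_le, Rinv_0_lt_compat; lra|].
  pose proof (pow_le r m hr0); nra. }
destruct h as [h | h]; [left; now apply exp_increasing | right; now rewrite h].
Qed.

Lemma geometric_steps_dist (u : nat -> R) (K r : R)
  (hr0 : 0 <= r) (hr1 : r < 1) (hK : 0 <= K)
  (hu : forall m, Rabs (u (S m) - u m) <= K * r ^ m) (m p : nat) :
  Rabs (u (m + p)%nat - u m) <= K / (1 - r) * r ^ m.
Proof.
(* The induction on [p] needs the exact partial geometric sum; the bound in the goal is too weak to
   reproduce itself. *)
assert (h : Rabs (u (m + p)%nat - u m) <= K / (1 - r) * (r ^ m - r ^ (m + p))).
{ induction p as [|p IH].
  - rewrite Nat.add_0_r, !Rminus_diag, Rabs_R0; lra.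
  - rewrite Nat.add_succ_r.
    replace (u (S (m + p)) - u m)
      with ((u (S (m + p)) - u (m + p)%nat) + (u (m + p)%nat - u m)) by ring.
    eapply Rle_trans; [apply Rabs_triang|].
    eapply Rle_trans; [apply Rplus_le_compat; [apply hu | exact IH]|].
    right; simpl; field; lra. }
eapply Rle_trans; [exact h|].
apply Rmult_le_compat_l; [apply Rdiv_le_0_compat; lra|].
pose proof (pow_le r (m + p) hr0); lra.
Qed.

Lemma geometric_lt (K r e : R) (hr0 : 0 <= r) (hr1 : r < 1) (hK : 0 <= K)
  (he : 0 < e) :
  exists N, forall m, (N <= m)%nat -> K * r ^ m < e.
Proof.
(* Dividing by [K + 1] instead of [K] covers the case [K = 0]. *)
destruct (pow_lt_1_zero r) with (y := e / (K + 1)) as [N hN].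
- rewrite Rabs_pos_eq; lra.
- apply Rdiv_lt_0_compat; lra.
- exists N; intros m hm.
  specialize (hN m hm).
  rewrite Rabs_pos_eq in hN by now apply pow_le.
  apply Rle_lt_trans with ((K + 1) * r ^ m).
  + pose proof (pow_le r m hr0); nra.
  + replace e with ((K + 1) * (e / (K + 1))) by (field; lra).
    apply Rmult_lt_compat_l; lra.
Qed.

Lemma geometric_steps_cauchy (u : nat -> R) (K r : R)
  (hr0 : 0 <= r) (hr1 : r < 1) (hK : 0 <= K)
  (hu : forall m, Rabs (u (S m) - u m) <= K * r ^ m) :
  ex_finite_lim_seq u.
Proof.
apply ex_lim_seq_cauchy_corr; intros e.
destruct (geometric_lt (K / (1 - r)) r (e / 2)) as [N hN]; trivial.
- apply Rdiv_le_0_compat; lra.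
- apply is_pos_div_2.
- exists N; intros n m hn hm.
  pose proof (geometric_steps_dist u K r hr0 hr1 hK hu N (n - N)) as h1.
  pose proof (geometric_steps_dist u K r hr0 hr1 hK hu N (m - N)) as h2.
  replace (N + (n - N))%nat with n in h1 by lia.
  replace (N + (m - N))%nat with m in h2 by lia.
  specialize (hN N (le_n N)).
  apply Rabs_le_between in h1; apply Rabs_le_between in h2.
  apply Rabs_def1; lra.
Qed.

(** Let [p] tend to infinity in [geometric_steps_dist]; its bound does not depend on [p]. *)
Lemma geometric_steps_lim (u : nat -> R) (l K r : R)
  (hr0 : 0 <= r) (hr1 : r < 1) (hK : 0 <= K)
  (hu : forall m, Rabs (u (S m) - u m) <= K * r ^ m)
  (hl : is_lim_seq u l) (m : nat) :
  Rabs (l - u m) <= K / (1 - r) * r ^ m.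
Proof.
apply (is_lim_seq_le (fun p => Rabs (u (p + m)%nat - u m))
         (fun _ => K / (1 - r) * r ^ m)
         (Rabs (l - u m)) (K / (1 - r) * r ^ m)).
- intros p; rewrite Nat.add_comm; now apply geometric_steps_dist.
- apply (is_lim_seq_abs _ (l - u m)).
  apply is_lim_seq_minus'; [|apply is_lim_seq_const].
  now apply is_lim_seq_incr_n.
- apply is_lim_seq_const.
Qed.

(** * Compact support, smoothness and finite Schwartz seminorms *)

Definition dilation_recursion (q : R) (phi : nat -> R -> R) : Prop :=
  forall m x, phi (S m) x = phi m x - / q ^ (m + 1) * dilation (1 / q) (phi m) x.

Definition vanishes_outside (B : R) (f : R -> R) : Prop :=
  forall x, B < Rabs x -> f x = 0.

Lemma compactly_supported_bound (f : R -> R) (hf : compactly_supported f) :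
  exists B, 0 < B /\ vanishes_outside B f.
Proof.
destruct (compact_P1 _ hf) as [m [M h]].
exists (Rabs m + Rabs M + 1).
pose proof (Rabs_pos m); pose proof (Rabs_pos M).
split; [lra|].
intros x hx.
destruct (Req_dec (f x) 0) as [h0 | h0]; trivial.
specialize (h x (adherence_P1 _ _ h0)).
revert hx; unfold Rabs; repeat destruct Rcase_abs; lra.
Qed.

Lemma smooth_locally (f : R -> R) (n : nat) (x : R) (hf : smooth f) :
  locally x (fun y => forall k, (k <= n)%nat -> ex_derive_n f k y).
Proof. apply filter_forall; intros y k _; apply hf. Qed.

Lemma smooth_continuous_Derive_n (f : R -> R) (n : nat) (x : R) (hf : smooth f) :
  continuous (Derive_n f n) x.
Proof. apply (ex_derive_continuous (Derive_n f n)), (hf (S n)). Qed.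

Lemma smooth_dilation (a : R) (f : R -> R) (hf : smooth f) : smooth (dilation a f).
Proof.
intros n x; apply ex_derive_n_comp_scal; now apply smooth_locally.
Qed.

(** On [[-B, B]] the weighted derivative is continuous, hence bounded. Beyond it [f] is zero on a
    whole neighbourhood of the point, so its derivatives are zero there too. *)
Lemma schwartz_of_vanishes_outside (f : R -> R) (B : R)
  (hf : smooth f) (hB : vanishes_outside B f) (k n : nat) :
  exists M, forall x, Rabs (x ^ k * Derive_n f n x) <= M.
Proof.
destruct (bounded_continuity (fun x => x ^ k * Derive_n f n x) (- B) B) as [M hM].
{ intros x _; apply (continuous_mult (fun x => x ^ k) (Derive_n f n)).
  - apply (ex_derive_continuous (fun x => x ^ k)); auto_derive; trivial.
  - now apply smooth_continuous_Derive_n. }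
exists (Rmax M 0); intros x.
destruct (Rle_lt_dec (Rabs x) B) as [hx | hx].
- apply Rle_trans with (2 := Rmax_l _ _), Rlt_le, hM.
  now apply Rabs_le_between.
- rewrite (Derive_n_ext_loc f (fun _ => 0)).
  + assert (h0 : Derive_n (fun _ => 0) n x = 0)
      by (destruct n; [reflexivity | apply Derive_n_const]).
    setoid_rewrite h0; rewrite Rmult_0_r, Rabs_R0; apply Rmax_r.
  + assert (hp : 0 < Rabs x - B) by lra.
    exists (mkposreal _ hp); intros y hy; apply hB.
    change (Rabs (y - x) < Rabs x - B) in hy.
    pose proof (Rabs_triang_inv x y) as h.
    rewrite (Rabs_minus_sym x y) in h; lra.
Qed.

(** * Seminorm estimates along the recursion *)

Lemma inv_pow_succ (q : R) (m : nat) (hq : 1 < q) :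
  / q ^ (m + 1) = / q * (/ q) ^ m.
Proof. rewrite pow_add, pow_inv; field; split; try apply pow_nonzero; lra. Qed.

Lemma recursion_smooth (q : R) (phi : nat -> R -> R)
  (hrec : dilation_recursion q phi) (h0 : smooth (phi 0%nat)) (m : nat) :
  smooth (phi m).
Proof.
induction m as [|m IH]; trivial.
intros n x.
apply (ex_derive_n_ext
         (fun x => phi m x - / q ^ (m + 1) * dilation (1 / q) (phi m) x)).
{ intros t; now rewrite hrec. }
apply ex_derive_n_minus; [now apply smooth_locally|].
apply filter_forall; intros y k _.
apply ex_derive_n_scal_l; now apply smooth_dilation.
Qed.

Lemma recursion_Derive_n (q : R) (phi : nat -> R -> R)
  (hrec : dilation_recursion q phi) (h0 : smooth (phi 0%nat)) (m n : nat) (x : R) :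
  Derive_n (phi (S m)) n x
  = Derive_n (phi m) n x
    - / q ^ (m + 1) * ((1 / q) ^ n * Derive_n (phi m) n (1 / q * x)).
Proof.
pose proof (recursion_smooth q phi hrec h0 m) as hm.
rewrite (Derive_n_ext _
          (fun x => phi m x - / q ^ (m + 1) * dilation (1 / q) (phi m) x));
  [|intros t; now rewrite hrec].
rewrite Derive_n_minus, Derive_n_scal_l.
- unfold dilation; rewrite Derive_n_comp_scal; trivial.
  now apply smooth_locally.
- now apply smooth_locally.
- apply filter_forall; intros y k _.
  apply ex_derive_n_scal_l; now apply smooth_dilation.
Qed.

(* The seminorm [sup |x^k f^(n)(x)|] of [D_{1/q} f] is [q^(k-n)] times that of [f]. *)
Lemma recursion_step (q : R) (phi : nat -> R -> R) (hq : 1 < q)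
  (hrec : dilation_recursion q phi) (h0 : smooth (phi 0%nat))
  (k n m : nat) (M : R)
  (hM : forall x, Rabs (x ^ k * Derive_n (phi m) n x) <= M) (x : R) :
  Rabs (x ^ k * Derive_n (phi (S m)) n x - x ^ k * Derive_n (phi m) n x)
  <= q ^ k * M * (/ q) ^ m.
Proof.
rewrite (recursion_Derive_n q phi hrec h0), inv_pow_succ by trivial.
assert (hq' : 0 < / q) by (apply Rinv_0_lt_compat; lra).
assert (hq1 : / q <= 1) by (rewrite <- Rinv_1; apply Rinv_le_contravar; lra).
assert (hM0 : 0 <= M) by (eapply Rle_trans; [apply Rabs_pos | apply (hM 0)]).
replace (1 / q) with (/ q) by (field; lra).
(* Writing [x ^ k] as [q ^ k * (/ q * x) ^ k] moves the weight to the dilated point, where [hM]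
   applies. *)
replace (_ - _) with
  (- ((/ q * (/ q) ^ n) * (q ^ k * (/ q) ^ m)
      * ((/ q * x) ^ k * Derive_n (phi m) n (/ q * x)))).
2:{ rewrite Rpow_mult_distr, (pow_inv q k); field; split; try apply pow_nonzero; lra. }
assert (hk : 0 <= q ^ k * (/ q) ^ m) by (apply Rmult_le_pos; apply pow_le; lra).
assert (hn : 0 <= / q * (/ q) ^ n) by (apply Rmult_le_pos; [|apply pow_le]; lra).
(* The gain [q^-(n+1)] from differentiation and from the coefficient is given up, which leaves a
   constant independent of [n]. *)
assert (hn1 : / q * (/ q) ^ n <= 1).
{ change ((/ q) ^ S n <= 1); rewrite <- (pow1 (S n)); apply pow_incr; lra. }
rewrite Rabs_Ropp, Rabs_mult, Rabs_pos_eq by now apply Rmult_le_pos.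
replace (q ^ k * M * (/ q) ^ m) with (1 * (q ^ k * (/ q) ^ m) * M) by ring.
apply Rmult_le_compat; trivial.
- now apply Rmult_le_pos.
- apply Rabs_pos.
- now apply Rmult_le_compat_r.
Qed.

(** By the triangle inequality, [recursion_step] multiplies the bound by [1 + q ^ k * (/ q) ^ m],
    the factor that [growth_step] absorbs. *)
Lemma recursion_seminorm_bounded (q : R) (phi : nat -> R -> R) (hq : 1 < q)
  (hrec : dilation_recursion q phi) (h0 : smooth (phi 0%nat)) (k n : nat) (C : R)
  (hC : forall x, Rabs (x ^ k * Derive_n (phi 0%nat) n x) <= C) (m : nat) (x : R) :
  Rabs (x ^ k * Derive_n (phi m) n x) <= C * growth (/ q) (q ^ k) m.
Proof.
assert (hq1 : / q < 1) by (rewrite <- Rinv_1; apply Rinv_lt_contravar; lra).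
assert (hC0 : 0 <= C) by (eapply Rle_trans; [apply Rabs_pos | apply (hC 0)]).
revert x; induction m as [|m IH]; intros x.
- now rewrite growth_0, Rmult_1_r.
- pose proof (recursion_step q phi hq hrec h0 k n m _ IH x) as h.
  pose proof (growth_step (/ q) (q ^ k) m hq1) as hg.
  specialize (IH x).
  apply Rle_trans with
    (C * ((1 + q ^ k * (/ q) ^ m) * growth (/ q) (q ^ k) m)).
  + apply Rabs_le_between in h; apply Rabs_le_between in IH.
    apply Rabs_le_between; lra.
  + now apply Rmult_le_compat_l.
Qed.

Lemma recursion_steps_geometric (q : R) (phi : nat -> R -> R) (hq : 1 < q)
  (hrec : dilation_recursion q phi) (h0 : smooth (phi 0%nat))
  (hsupp : compactly_supported (phi 0%nat)) (k n : nat) :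
  exists K, 0 <= K /\ forall m x,
    Rabs (x ^ k * Derive_n (phi (S m)) n x - x ^ k * Derive_n (phi m) n x)
    <= K * (/ q) ^ m.
Proof.
destruct (compactly_supported_bound _ hsupp) as [B [_ hB]].
destruct (schwartz_of_vanishes_outside _ B h0 hB k n) as [C hC].
assert (hq0 : 0 < / q) by (apply Rinv_0_lt_compat; lra).
assert (hq1 : / q < 1) by (rewrite <- Rinv_1; apply Rinv_lt_contravar; lra).
assert (hC0 : 0 <= C) by (eapply Rle_trans; [apply Rabs_pos | apply (hC 0)]).
assert (hqk : 0 <= q ^ k) by (apply pow_le; lra).
(* [E] bounds every [growth (/ q) (q ^ k) m]. The resulting seminorm bound [C * E], uniform in [m],
   is fed back into [recursion_step]. *)
set (E := exp (q ^ k / (1 - / q))).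
exists (q ^ k * (C * E)); split.
{ repeat apply Rmult_le_pos; trivial; apply Rlt_le, exp_pos. }
intros m; apply recursion_step; trivial.
intros x; apply Rle_trans with (C * growth (/ q) (q ^ k) m).
- now apply recursion_seminorm_bounded.
- apply Rmult_le_compat_l; trivial; apply growth_le; lra.
Qed.

(** * The limit function in the Schwartz space *)

(** The case [n = 0] is [psi]. The other cases are limits of derivatives, identified with the
    derivatives of [psi] only in [Derive_n_lim]. [Lim_seq] is total, so convergence is a separate
    matter, settled by [recursion_limit]. *)
Definition lim_Derive_n (phi : nat -> R -> R) (n : nat) (x : R) : R :=
  Lim_seq (fun m => Derive_n (phi m) n x).

Lemma recursion_limit (q : R) (phi : nat -> R -> R) (hq : 1 < q)
  (hrec : dilation_recursion q phi) (h0 : smooth (phi 0%nat))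
  (hsupp : compactly_supported (phi 0%nat)) (n : nat) (x : R) :
  is_lim_seq (fun m => Derive_n (phi m) n x) (lim_Derive_n phi n x).
Proof.
assert (hq0 : 0 < / q) by (apply Rinv_0_lt_compat; lra).
assert (hq1 : / q < 1) by (rewrite <- Rinv_1; apply Rinv_lt_contravar; lra).
destruct (recursion_steps_geometric q phi hq hrec h0 hsupp 0 n) as [K [hK h]].
destruct (geometric_steps_cauchy (fun m => Derive_n (phi m) n x) K (/ q))
  as [l hl]; try lra.
- intros m; specialize (h m x); simpl in h; now rewrite !Rmult_1_l in h.
- unfold lim_Derive_n; now rewrite (is_lim_seq_unique _ _ hl).
Qed.

(** The weight [x ^ k] serves three purposes: [k = 0] gives uniform convergence, arbitrary [k] gives
    rapid decay of the limit, and [k = n], [k = n + 2] allow passing to the limit in the moments. *)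
Lemma recursion_limit_rate (q : R) (phi : nat -> R -> R) (hq : 1 < q)
  (hrec : dilation_recursion q phi) (h0 : smooth (phi 0%nat))
  (hsupp : compactly_supported (phi 0%nat)) (k n : nat) :
  exists K, 0 <= K /\ forall m x,
    Rabs (x ^ k * (lim_Derive_n phi n x - Derive_n (phi m) n x)) <= K * (/ q) ^ m.
Proof.
assert (hq0 : 0 < / q) by (apply Rinv_0_lt_compat; lra).
assert (hq1 : / q < 1) by (rewrite <- Rinv_1; apply Rinv_lt_contravar; lra).
destruct (recursion_steps_geometric q phi hq hrec h0 hsupp k n) as [K [hK h]].
exists (K / (1 - / q)); split; [apply Rdiv_le_0_compat; lra|].
intros m x; rewrite Rmult_minus_distr_l.
apply (geometric_steps_lim (fun m => x ^ k * Derive_n (phi m) n x)); try lra.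
- intros p; apply h.
- apply (is_lim_seq_scal_l _ (x ^ k) (lim_Derive_n phi n x)).
  now apply (recursion_limit q).
Qed.

(** [CVU_dom] measures the distance to the pointwise [Lim_seq], so the limit meant here is
    [lim_Derive_n phi n]. *)
Lemma recursion_limit_CVU (q : R) (phi : nat -> R -> R) (hq : 1 < q)
  (hrec : dilation_recursion q phi) (h0 : smooth (phi 0%nat))
  (hsupp : compactly_supported (phi 0%nat)) (n : nat) :
  CVU_dom (fun m => Derive_n (phi m) n) (fun _ => True).
Proof.
assert (hq0 : 0 < / q) by (apply Rinv_0_lt_compat; lra).
assert (hq1 : / q < 1) by (rewrite <- Rinv_1; apply Rinv_lt_contravar; lra).
destruct (recursion_limit_rate q phi hq hrec h0 hsupp 0 n) as [K [hK h]].
intros e.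
destruct (geometric_lt K (/ q) e) as [N hN]; try lra; [apply cond_pos|].
exists N; intros m hm x _.
specialize (h m x); specialize (hN m hm).
simpl in h; rewrite Rmult_1_l, Rabs_minus_sym in h.
exact (Rle_lt_trans _ _ _ h hN).
Qed.

(** Limit and derivative may be exchanged because both the functions and their continuous
    derivatives converge uniformly. *)
Lemma is_derive_lim_Derive_n (q : R) (phi : nat -> R -> R) (hq : 1 < q)
  (hrec : dilation_recursion q phi) (h0 : smooth (phi 0%nat))
  (hsupp : compactly_supported (phi 0%nat)) (n : nat) (x : R) :
  is_derive (lim_Derive_n phi n) x (lim_Derive_n phi (S n) x).
Proof.
pose proof (recursion_smooth q phi hrec h0) as hs.
apply (CVU_Derive (fun m => Derive_n (phi m) n) (fun _ => True)); trivial.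
- apply open_true.
- intros a b y _ _ _; exact I.
- now apply (recursion_limit_CVU q).
- intros m y _; apply (hs m (S n)).
- intros m y _; apply continuity_pt_filterlim.
  apply (smooth_continuous_Derive_n (phi m) (S n)), hs.
- now apply (recursion_limit_CVU q phi hq hrec h0 hsupp (S n)).
Qed.

Lemma Derive_n_lim (q : R) (phi : nat -> R -> R) (hq : 1 < q)
  (hrec : dilation_recursion q phi) (h0 : smooth (phi 0%nat))
  (hsupp : compactly_supported (phi 0%nat)) (n : nat) (x : R) :
  Derive_n (lim_Derive_n phi 0) n x = lim_Derive_n phi n x.
Proof.
revert x; induction n as [|n IH]; intros x; [reflexivity|].
simpl; rewrite (Derive_ext _ _ _ IH).
now apply is_derive_unique, (is_derive_lim_Derive_n q).
Qed.

Lemma smooth_lim (q : R) (phi : nat -> R -> R) (hq : 1 < q)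
  (hrec : dilation_recursion q phi) (h0 : smooth (phi 0%nat))
  (hsupp : compactly_supported (phi 0%nat)) :
  smooth (lim_Derive_n phi 0).
Proof.
intros [|n] x; [exact I|].
exists (lim_Derive_n phi (S n) x).
apply (is_derive_ext (lim_Derive_n phi n)).
- intros t; symmetry; now apply (Derive_n_lim q).
- now apply (is_derive_lim_Derive_n q).
Qed.

Lemma schwartz_lim (q : R) (phi : nat -> R -> R) (hq : 1 < q)
  (hrec : dilation_recursion q phi) (h0 : smooth (phi 0%nat))
  (hsupp : compactly_supported (phi 0%nat)) :
  schwartz (lim_Derive_n phi 0).
Proof.
split; [now apply (smooth_lim q)|].
intros k n.
destruct (compactly_supported_bound _ hsupp) as [B [_ hB]].
destruct (schwartz_of_vanishes_outside _ B h0 hB k n) as [C hC].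
destruct (recursion_limit_rate q phi hq hrec h0 hsupp k n) as [K [hK h]].
exists (C + K); intros x.
rewrite (Derive_n_lim q) by trivial.
(* Comparison with [phi 0] already suffices: its seminorm is at most [C], and the rate at [m = 0] is
   [K]. *)
specialize (h 0%nat x); specialize (hC x).
rewrite Rmult_minus_distr_l in h; simpl in h.
apply Rabs_le_between in h; apply Rabs_le_between in hC.
apply Rabs_le_between; lra.
Qed.

(** * Behaviour at and near the origin *)

(** Since [q > 1], the map [x -> x / q] sends [[-eps, eps]] into itself, so the same interval works
    for every [m]. *)
Lemma recursion_constant_near_0 (q eps : R) (phi : nat -> R -> R) (hq : 1 < q)
  (hrec : dilation_recursion q phi)
  (h1 : forall x, - eps <= x <= eps -> phi 0%nat x = 1) (m : nat) (x : R) :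
  - eps <= x <= eps -> phi m x = phi m 0.
Proof.
assert (hq0 : 0 < / q) by (apply Rinv_0_lt_compat; lra).
assert (hq1 : / q < 1) by (rewrite <- Rinv_1; apply Rinv_lt_contravar; lra).
revert x; induction m as [|m IH]; intros x hx.
- rewrite !h1; lra.
- rewrite !hrec; unfold dilation.
  rewrite Rmult_0_r, (IH x hx), (IH (1 / q * x)); trivial.
  unfold Rdiv; rewrite Rmult_1_l; nra.
Qed.

(* [growth] bounds the product of the [1 / (1 - r^i)], since
   [1 / (1 - r^(m+1)) <= 1 + r^m / (1 - r)]. *)
Lemma recursion_at_0_lower (q : R) (phi : nat -> R -> R) (hq : 1 < q)
  (hrec : dilation_recursion q phi) (h1 : phi 0%nat 0 = 1) (m : nat) :
  1 <= phi m 0 * growth (/ q) (/ (1 - / q)) m.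
Proof.
assert (hq0 : 0 < / q) by (apply Rinv_0_lt_compat; lra).
assert (hq1 : / q < 1) by (rewrite <- Rinv_1; apply Rinv_lt_contravar; lra).
induction m as [|m IH].
- rewrite h1, growth_0; lra.
- rewrite hrec; unfold dilation.
  rewrite Rmult_0_r, inv_pow_succ by trivial.
  revert IH; set (r := / q) in *; set (K := / (1 - r)); intros IH.
  assert (hm0 : 0 < r ^ m) by now apply pow_lt.
  assert (hm1 : r ^ m <= 1) by (rewrite <- (pow1 m); apply pow_incr; lra).
  assert (hK : K * (1 - r) = 1) by (unfold K; field; lra).
  assert (hKp : 0 < K) by (apply Rinv_0_lt_compat; lra).
  assert (hg := growth_pos r K m).
  assert (hphi : 0 < phi m 0) by nra.
  assert (hstep := growth_step r K m hq1).
  assert (hrm : r * r ^ m <= r) by nra.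
  assert (hKr : K * (r * r ^ m) <= K * r) by (apply Rmult_le_compat_l; lra).
  (* The bracket [K - r - K * (r * r ^ m)] is at least [K - r - K * r], which equals [1 - r] because
     [K * (1 - r) = 1]. *)
  assert (hone : 1 <= (1 - r * r ^ m) * (1 + K * r ^ m)).
  { replace ((1 - r * r ^ m) * (1 + K * r ^ m))
      with (1 + r ^ m * (K - r - K * (r * r ^ m))) by ring.
    assert (0 <= r ^ m * (K - r - K * (r * r ^ m))) by (apply Rmult_le_pos; lra).
    lra. }
  apply Rle_trans with (1 := IH).
  replace ((phi m 0 - r * r ^ m * phi m 0) * growth r K (S m))
    with (phi m 0 * ((1 - r * r ^ m) * growth r K (S m))) by ring.
  apply Rmult_le_compat_l; [lra|].
  apply Rle_trans with ((1 - r * r ^ m) * ((1 + K * r ^ m) * growth r K m)).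
  + rewrite <- Rmult_assoc; nra.
  + apply Rmult_le_compat_l; [lra | exact hstep].
Qed.

(** Positivity of each [phi m 0] could be lost in the limit; the lower bound [/ E], uniform in [m],
    is not. *)
Lemma lim_at_0_pos (q : R) (phi : nat -> R -> R) (hq : 1 < q)
  (hrec : dilation_recursion q phi) (h0 : smooth (phi 0%nat))
  (hsupp : compactly_supported (phi 0%nat)) (h1 : phi 0%nat 0 = 1) :
  0 < lim_Derive_n phi 0 0.
Proof.
assert (hq0 : 0 < / q) by (apply Rinv_0_lt_compat; lra).
assert (hq1 : / q < 1) by (rewrite <- Rinv_1; apply Rinv_lt_contravar; lra).
set (E := exp (/ (1 - / q) / (1 - / q))).
assert (hE : 0 < E) by apply exp_pos.
apply Rlt_le_trans with (/ E); [now apply Rinv_0_lt_compat|].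
apply (is_lim_seq_le (fun _ => / E) (fun m => phi m 0)
         (/ E) (lim_Derive_n phi 0 0)).
- intros m.
  pose proof (recursion_at_0_lower q phi hq hrec h1 m) as h.
  assert (hg : growth (/ q) (/ (1 - / q)) m <= E).
  { apply growth_le; try lra. apply Rlt_le, Rinv_0_lt_compat; lra. }
  pose proof (growth_pos (/ q) (/ (1 - / q)) m) as hg0.
  assert (hphi : 0 < phi m 0) by nra.
  apply Rmult_le_reg_r with E; trivial.
  rewrite Rinv_l by lra; nra.
- apply is_lim_seq_const.
- now apply (recursion_limit q phi hq hrec h0 hsupp 0 0).
Qed.

Lemma lim_flat_at_0 (q eps : R) (phi : nat -> R -> R) (hq : 1 < q) (heps : 0 < eps)
  (hrec : dilation_recursion q phi)
  (h1 : forall x, - eps <= x <= eps -> phi 0%nat x = 1)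
  (k : nat) (hk : (1 <= k)%nat) :
  is_derive_n (lim_Derive_n phi 0) k 0 0.
Proof.
destruct k as [|k]; [lia|].
apply (is_derive_n_ext_loc (fun _ => lim_Derive_n phi 0 0)).
- exists (mkposreal _ heps); intros y hy.
  change (Rabs (y - 0) < eps) in hy.
  rewrite Rminus_0_r in hy; apply Rabs_def2 in hy.
  apply (f_equal real), Lim_seq_ext; intros m; symmetry.
  apply (recursion_constant_near_0 q eps phi hq hrec h1 m y); lra.
- apply is_derive_n_const.
Qed.

(** * Evenness of the iterates and of the limit *)

Lemma recursion_even (q : R) (phi : nat -> R -> R)
  (hrec : dilation_recursion q phi) (h0 : even_fun (phi 0%nat)) (m : nat) :
  even_fun (phi m).
Proof.
induction m as [|m IH]; trivial.
intros x; rewrite !hrec; unfold dilation.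
rewrite <- Ropp_mult_distr_r; now rewrite !IH.
Qed.

Lemma even_lim (phi : nat -> R -> R) (h : forall m, even_fun (phi m)) :
  even_fun (lim_Derive_n phi 0).
Proof.
intros x; apply (f_equal real), Lim_seq_ext; intros m; apply h.
Qed.

(** * Vanishing moments *)

(** The integral over the line in the form suited to bounded support: proper integrals over all
    large intervals agree, and no limit is taken. [B] is existential because dilation by [1 / q]
    enlarges the support at each step. *)
Definition is_integral_wide (f : R -> R) (I : R) : Prop :=
  exists B, 0 < B /\ forall a b, a <= - B -> B <= b -> is_RInt f a b I.

Lemma integral_wide_of_vanishes_outside (f : R -> R) (B : R) (hB : 0 < B)
  (hf : forall x, continuous f x) (h : vanishes_outside B f) :
  is_integral_wide f (RInt f (- B) B).
Proof.
assert (hzero : forall a b, a <= b -> b <= - B \/ B <= a -> is_RInt f a b 0).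
{ intros a b hab hout.
  replace 0 with (scal (b - a) (zero : R)) by exact (Rmult_0_r _).
  apply (is_RInt_ext (fun _ => zero : R)); [|apply (@is_RInt_const R_NormedModule)].
  (* [is_RInt_ext] asks for equality on the open interval only, which gives the strict inequality
     that [vanishes_outside] requires. *)
  intros x; rewrite Rmin_left, Rmax_right by trivial; intros hx.
  symmetry; apply h; unfold Rabs; destruct Rcase_abs; lra. }
exists B; split; trivial; intros a b ha hb.
replace (RInt f (- B) B) with (plus (plus 0 (RInt f (- B) B)) 0)
  by (change (0 + RInt f (- B) B + 0 = RInt f (- B) B); ring).
apply (is_RInt_Chasles f a B b); [apply (is_RInt_Chasles f a (- B) B)|].
- apply hzero; lra.
- apply (RInt_correct f), (ex_RInt_continuous f); intros z _; apply hf.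
- apply hzero; lra.
Qed.

Lemma integral_wide_dilation (f : R -> R) (a I : R) (ha : 0 < a)
  (h : is_integral_wide f I) :
  is_integral_wide (dilation a f) (/ a * I).
Proof.
destruct h as [B [hB h]].
exists (B / a); split; [now apply Rdiv_lt_0_compat|].
intros u v hu hv.
apply (Rmult_le_compat_l a) in hu; [|lra].
apply (Rmult_le_compat_l a) in hv; [|lra].
replace (a * - (B / a)) with (- B) in hu by (field; lra).
replace (a * (B / a)) with B in hv by (field; lra).
assert (hl : is_RInt f (a * u + 0) (a * v + 0) I)
  by (rewrite !Rplus_0_r; now apply h).
generalize (is_RInt_scal _ _ _ (/ a) _ (is_RInt_comp_lin f a 0 u v I hl)).
apply is_RInt_ext; intros x _; unfold dilation.
change (/ a * (a * f (a * x + 0)) = f (a * x)).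
rewrite Rplus_0_r; field; lra.
Qed.

(** As [t ^ n = q ^ n * (t / q) ^ n], the dilated term is [q ^ n] times the dilation of
    [phi m t * t ^ n], and the change of variables contributes one more factor [q]. *)
Lemma recursion_moment (q : R) (phi : nat -> R -> R) (hq : 1 < q)
  (hrec : dilation_recursion q phi) (n m : nat) (I : R)
  (h : is_integral_wide (fun t => phi m t * t ^ n) I) :
  is_integral_wide (fun t => phi (S m) t * t ^ n)
    ((1 - q ^ (n + 1) / q ^ (m + 1)) * I).
Proof.
assert (hq' : 0 < 1 / q) by (apply Rdiv_lt_0_compat; lra).
destruct (integral_wide_dilation _ (1 / q) I hq' h) as [B' [hB' h']].
destruct h as [B [hB h]].
exists (Rmax B B'); split; [now apply Rlt_le_trans with (2 := Rmax_l _ _)|].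
intros a b ha hb.
pose proof (Rmax_l B B'); pose proof (Rmax_r B B').
specialize (h a b ltac:(lra) ltac:(lra)); specialize (h' a b ltac:(lra) ltac:(lra)).
pose proof (is_RInt_minus _ _ _ _ _ _ h
  (is_RInt_scal _ _ _ (q ^ n / q ^ (m + 1)) _ h')) as h''.
assert (hpow : forall p, q ^ p <> 0) by (intros p; apply pow_nonzero; lra).
replace ((1 - q ^ (n + 1) / q ^ (m + 1)) * I)
  with (minus I (scal (q ^ n / q ^ (m + 1)) (/ (1 / q) * I))).
- revert h''; apply is_RInt_ext; intros t _.
  unfold dilation.
  change (phi m t * t ^ n
    - q ^ n / q ^ (m + 1) * (phi m (1 / q * t) * (1 / q * t) ^ n)
    = phi (S m) t * t ^ n).
  rewrite hrec; unfold dilation, Rdiv.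
  rewrite Rpow_mult_distr, Rmult_1_l, (pow_inv q n); field; auto.
- change (I - q ^ n / q ^ (m + 1) * (/ (1 / q) * I)
    = (1 - q ^ (n + 1) / q ^ (m + 1)) * I).
  rewrite !pow_add; simpl; field; split; [lra | auto].
Qed.

Lemma recursion_moment_vanishes (q : R) (phi : nat -> R -> R) (hq : 1 < q)
  (hrec : dilation_recursion q phi) (h0 : smooth (phi 0%nat))
  (hsupp : compactly_supported (phi 0%nat)) (n m : nat) (hnm : (n < m)%nat) :
  is_integral_wide (fun t => phi m t * t ^ n) 0.
Proof.
(* The moment at [m = n] may have any value, but it has to exist before it can be multiplied by
   zero. *)
assert (hex : forall m, exists I, is_integral_wide (fun t => phi m t * t ^ n) I).
{ induction m0 as [|p [I hI]].
  - destruct (compactly_supported_bound _ hsupp) as [B [hB hout]].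
    eexists; apply (integral_wide_of_vanishes_outside _ B hB).
    + intros x; apply (continuous_mult (phi 0%nat) (fun t => t ^ n)).
      * now apply (smooth_continuous_Derive_n (phi 0%nat) 0).
      * apply (ex_derive_continuous (fun t => t ^ n)); auto_derive; trivial.
    + intros x hx; rewrite hout by trivial; ring.
  - eexists; apply recursion_moment; eauto. }
induction hnm as [|m _ IH].
(* The step from [n] to [n + 1] carries the factor [1 - q ^ (n + 1) / q ^ (n + 1) = 0]; every later
   step preserves the value 0. *)
- destruct (hex n) as [I hI].
  apply (recursion_moment q phi hq hrec) in hI.
  replace 0 with ((1 - q ^ (n + 1) / q ^ (n + 1)) * I); trivial.
  field; apply pow_nonzero; lra.
- apply (recursion_moment q phi hq hrec) in IH.
  now rewrite Rmult_0_r in IH.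
Qed.

(** The function [1 / (1 + x^2)] has primitive [atan], whose total variation is [PI]; hence a bound
    that does not depend on [a] and [b]. *)
Lemma RInt_weighted_bound (f : R -> R) (a b I e : R) (hab : a <= b)
  (he : 0 <= e) (hf : is_RInt f a b I)
  (h : forall x, Rabs (f x) * (1 + x ^ 2) <= e) :
  Rabs I <= e * PI.
Proof.
assert (hpos : forall x, 0 < 1 + x ^ 2) by (intros x; pose proof (pow2_ge_0 x); lra).
apply Rle_trans with (e * (atan b - atan a)).
- apply (norm_RInt_le f (fun x => e * / (1 + x ^ 2)) a b I); trivial.
  + intros x _; change (Rabs (f x) <= e * / (1 + x ^ 2)).
    apply Rmult_le_reg_r with (1 + x ^ 2); trivial.
    rewrite Rmult_assoc, Rinv_l, Rmult_1_r; [apply h|].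
    apply Rgt_not_eq, hpos.
  + apply (is_RInt_scal (fun x => / (1 + x ^ 2)) a b e (minus (atan b) (atan a))).
    apply (is_RInt_derive atan (fun x => / (1 + x ^ 2))).
    * intros x _; apply is_derive_Reals, derivable_pt_lim_atan.
    * intros x _; apply (ex_derive_continuous (fun x => / (1 + x ^ 2))).
      auto_derive; apply Rgt_not_eq; pose proof (hpos x); simpl in *; lra.
- apply Rmult_le_compat_l; trivial.
  pose proof (atan_bound a); pose proof (atan_bound b); lra.
Qed.

(** The moment of [phi M] is exactly 0 on large intervals, so the integral of [psi t * t ^ n] there
    equals that of the difference, which [RInt_weighted_bound] makes small uniformly in the
    interval. *)
Lemma lim_moment (q : R) (phi : nat -> R -> R) (hq : 1 < q)
  (hrec : dilation_recursion q phi) (h0 : smooth (phi 0%nat))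
  (hsupp : compactly_supported (phi 0%nat)) (n : nat) :
  is_integral_line (fun t => lim_Derive_n phi 0 t * t ^ n) 0.
Proof.
set (psi := lim_Derive_n phi 0).
assert (hq0 : 0 < / q) by (apply Rinv_0_lt_compat; lra).
assert (hq1 : / q < 1) by (rewrite <- Rinv_1; apply Rinv_lt_contravar; lra).
pose proof PI_RGT_0 as hpi.
destruct (recursion_limit_rate q phi hq hrec h0 hsupp n 0) as [K1 [hK1 h1]].
(* The weights [n] and [n + 2] together control [x ^ n * (1 + x ^ 2)]. *)
destruct (recursion_limit_rate q phi hq hrec h0 hsupp (n + 2) 0) as [K2 [hK2 h2]].
intros P [e he].
destruct (geometric_lt (K1 + K2) (/ q) (e / PI)) as [N hN]; try lra.
{ apply Rdiv_lt_0_compat; [apply cond_pos | lra]. }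
(* [M] is at least [N], for the error bound, and exceeds [n], for the vanishing moment. *)
set (M := (N + S n)%nat).
specialize (hN M ltac:(lia)).
destruct (recursion_moment_vanishes q phi hq hrec h0 hsupp n M ltac:(lia))
  as [B [hB hM]].
apply (Filter_prod _ _ _ (fun a => a < - B) (fun b => B < b)).
{ exists (- B); trivial. }
{ exists B; trivial. }
intros a b ha hb; simpl.
assert (hint : is_RInt (fun t => psi t * t ^ n) a b
                 (RInt (fun t => psi t * t ^ n) a b)).
{ apply (RInt_correct (fun t => psi t * t ^ n)),
    (ex_RInt_continuous (fun t => psi t * t ^ n)).
  intros x _; apply (continuous_mult psi (fun t => t ^ n)).
  - apply (smooth_continuous_Derive_n psi 0); now apply (smooth_lim q).
  - apply (ex_derive_continuous (fun t => t ^ n)); auto_derive; trivial. }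
eexists; split; [exact hint|].
apply he.
set (I := RInt (fun t => psi t * t ^ n) a b) in *.
change (Rabs (I - 0) < e).
pose proof (is_RInt_minus _ _ _ _ _ _ hint (hM a b ltac:(lra) ltac:(lra))) as hd.
apply Rle_lt_trans with ((K1 + K2) * (/ q) ^ M * PI).
- apply (RInt_weighted_bound _ a b (I - 0) ((K1 + K2) * (/ q) ^ M)
           ltac:(lra)) with (2 := hd).
  + apply Rmult_le_pos; [|apply pow_le]; lra.
  + intros x; specialize (h1 M x); specialize (h2 M x).
    change (Rabs (psi x * x ^ n - phi M x * x ^ n) * (1 + x ^ 2)
      <= (K1 + K2) * (/ q) ^ M).
    simpl Derive_n in h1, h2; fold psi in h1, h2.
    replace (psi x * x ^ n - phi M x * x ^ n)
      with (x ^ n * (psi x - phi M x)) by ring.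
    rewrite pow_add in h2.
    replace (x ^ n * x ^ 2 * (psi x - phi M x))
      with (x ^ n * (psi x - phi M x) * x ^ 2) in h2 by ring.
    rewrite Rabs_mult, (Rabs_pos_eq (x ^ 2)) in h2 by apply pow2_ge_0.
    lra.
- apply (Rmult_lt_compat_r PI) in hN; trivial.
  replace (e / PI * PI) with (pos e) in hN by (field; lra).
  exact hN.
Qed.

Theorem lemma11 (phi : nat -> R -> R) (q eps : R)
  (phi0_smooth : smooth (phi 0%nat))
  (phi0_supp : compactly_supported (phi 0%nat))
  (phi0_even : even_fun (phi 0%nat))
  (hq : 1 < q) (heps : 0 < eps)
  (phi0_one : forall x, - eps <= x <= eps -> phi 0%nat x = 1)
  (phi_rec : forall (m : nat) (x : R),
      phi (S m) x = phi m x - / q ^ (m + 1) * dilation (1 / q) (phi m) x) :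
  exists psi : R -> R,
    converges_uniformly phi psi /\
    even_fun psi /\
    (exists c : R, c <> 0 /\ psi 0 = c /\
       forall k : nat, (1 <= k)%nat -> is_derive_n psi k 0 0) /\
    schwartz_star_1 psi.
Proof.
assert (heven : even_fun (lim_Derive_n phi 0))
  by (apply even_lim; now apply (recursion_even q)).
exists (lim_Derive_n phi 0); repeat split; trivial.
- apply filterlim_locally; intros e.
  destruct (recursion_limit_CVU q phi hq phi_rec phi0_smooth phi0_supp 0 e) as [N hN].
  exists N; intros m hm x; now apply hN.
- exists (lim_Derive_n phi 0 0); repeat split.
  + apply Rgt_not_eq, (lim_at_0_pos q); trivial.
    apply phi0_one; lra.
  + now apply (lim_flat_at_0 q eps).
- now apply (smooth_lim q).
- now apply (schwartz_lim q).
- now apply (lim_moment q).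
(* Evenness of [psi] reduces the reflected moments to the direct ones. *)
- pose proof (lim_moment q phi hq phi_rec phi0_smooth phi0_supp m) as h.
  apply (is_RInt_gen_ext (fun t => lim_Derive_n phi 0 t * t ^ m)); trivial.
  apply filter_forall; intros ab x _; now rewrite heven.
Qed.
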